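(* Let $R$ be a commutative ring, $\underline{x} = x_1,\ldots,x_k$ a finite sequence of elements of $R$, $J = (x_1,\ldots,x_k)R$, $X = \operatorname{Spec} R$ and $U = X\setminus V(J)$. For every $R$-module $M$ there is an isomorphism $$\check{D}^0_{\underline{x}}(M)\cong\tilde{M}(U).$$
   Context: $R$ is not assumed Noetherian. $\check{D}^0_{\underline{x}}(M)$ is the kernel of the Čech differential $$d^1:\bigoplus_{i=1}^k M_{x_i}\to\bigoplus_{1\le i<j\le k}M_{x_ix_j},$$ i.e. the set of families $(m_i/x_i^n)_{i=1}^k$ with $m_i/x_i^n = m_j/x_j^n$ in $M_{x_ix_j}$ for all $i,j$. $\tilde{M}$ is the sheaf of modules on $X = \operatorname{Spec} R$ associated with $M$, so that $\tilde{M}(D(x)) = M_x$ for $x\in R$, where $D(x) = X\setminus V(x)$. For $x,y\in J$ with $D(x)\subseteq D(y)$, i.e. $x^l = yr$ for some $l\ge1$ and $r\in R$, the restriction map is $\alpha_{x,y}:M_y\to M_x$, $m/y^n\mapsto r^nm/x^{ln}$. $\tilde{M}(U) = \Gamma(U,\tilde{M})$ is the $R$-module of sections over the open set $U$, which is covered by $D(x_1),\ldots,D(x_k)$. *)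

(* Defs.v *)
From HB Require Import structures.
From mathcomp Require Import all_boot all_algebra.
From mathcomp Require Import all_classical.
From mathcomp Require Import topology.
From mathcomp Require Import ring.

Set Implicit Arguments.
Unset Strict Implicit.
Unset Printing Implicit Defensive.

Import GRing.Theory.
Local Open Scope ring_scope.
Local Open Scope quotient_scope.
Local Open Scope classical_set_scope.

Section DirectProduct.
Variables (R : pzRingType) (I : Type) (F : I -> lmodType R).

(* An alias, since plain function types already carry a non-dependent module
   structure. For finite I this is also the direct sum. *)
Definition dprod : Type := forall i, F i.

HB.instance Definition _ := Choice.copy dprod (forall i, F i).

Let add (f g : dprod) : dprod := fun i => f i + g i.
Let opp (f : dprod) : dprod := fun i => - f i.
Let zero : dprod := fun i => 0.
Let scale (a : R) (f : dprod) : dprod := fun i => a *: f i.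

Let addA : associative add.
Proof. by move=> f g h; apply: functional_extensionality_dep => i; exact: addrA. Qed.
Let addC : commutative add.
Proof. by move=> f g; apply: functional_extensionality_dep => i; exact: addrC. Qed.
Let add0 : left_id zero add.
Proof. by move=> f; apply: functional_extensionality_dep => i; exact: add0r. Qed.
Let addN : left_inverse zero opp add.
Proof. by move=> f; apply: functional_extensionality_dep => i; exact: addNr. Qed.

HB.instance Definition _ := GRing.isZmodule.Build dprod addA addC add0 addN.

Let scaleA a b f : scale a (scale b f) = scale (a * b) f.
Proof. by apply: functional_extensionality_dep => i; exact: scalerA. Qed.
Let scale1 : left_id 1 scale.
Proof. by move=> f; apply: functional_extensionality_dep => i; exact: scale1r. Qed.
Let scaleDr : right_distributive scale +%R.
Proof. by move=> a f g; apply: functional_extensionality_dep => i; exact: scalerDr. Qed.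
Let scaleDl f : {morph scale^~ f : a b / a + b}.
Proof. by move=> a b; apply: functional_extensionality_dep => i; exact: scalerDl. Qed.

HB.instance Definition _ :=
  GRing.Zmodule_isLmodule.Build R dprod scaleA scale1 scaleDr scaleDl.

End DirectProduct.

Section Kernel.
Variables (R : pzRingType) (U V : lmodType R) (f : {linear U -> V}).

Definition ker_pred : {pred U} := fun u => f u == 0.

Let ker_closed : submod_closed ker_pred.
Proof.
split=> [|a u v]; rewrite !unfold_in; first by rewrite linear0.
by move=> /eqP fu /eqP fv; rewrite linearP fu fv scaler0 addr0.
Qed.
HB.instance Definition _ :=
  GRing.isSubmodClosed.Build R U ker_pred (GRing.submod_closed_semi ker_closed).

Definition linear_ker : Type := {u : U | u \in ker_pred}.
HB.instance Definition _ := SubChoice.on linear_ker.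
HB.instance Definition _ := [SubChoice_isSubLmodule of linear_ker by <:].

End Kernel.

Definition denom (R : Type) (S : {pred R}) (a : R) (aS : a \in S) :
  {s : R | s \in S} := exist _ a aS.

(* The module of fractions S^-1 M; the pairs (m, s) and (m', s') are identified
   when t s' m = t s m' for some t in S. *)
Section Localization.
Variables (R : comPzRingType) (S : mulrClosed R) (M : lmodType R).

Let pair : Type := (M * {s : R | s \in S})%type.

Definition frac_eq : rel pair := fun u v =>
  `[< exists2 t, t \in S & t *: (sval v.2 *: u.1) = t *: (sval u.2 *: v.1) >].

Let frac_eq_class : equiv_class_of frac_eq.
Proof.
split=> [u|u v|v u w].
- by apply/asboolP; exists 1; rewrite ?rpred1.
- by apply/asboolP/asboolP => -[t tS e]; exists t.
- move=> /asboolP [t tS e1] /asboolP [t' t'S e2]; apply/asboolP.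
  exists (sval v.2 * (t * t')); first by rewrite !rpredM // (svalP v.2).
  rewrite !scalerA in e1 e2 *.
  have -> : sval v.2 * (t * t') * sval w.2 = t' * sval w.2 * (t * sval v.2) by ring.
  rewrite -scalerA e1 scalerA.
  have -> : t' * sval w.2 * (t * sval u.2) = t * sval u.2 * (t' * sval w.2) by ring.
  by rewrite -scalerA e2 scalerA; congr (_ *: _); ring.
Qed.

Canonical frac_eq_equiv := EquivRelPack frac_eq_class.
Canonical frac_eq_encModRel := defaultEncModRel frac_eq.

Definition localization : Type := {eq_quot frac_eq}.
HB.instance Definition _ := EqQuotient.on localization.
HB.instance Definition _ := Choice.on localization.

Definition frac (m : M) (s : {s : R | s \in S}) : localization :=
  \pi_localization (m, s).

Let one : {s : R | s \in S} := denom (rpred1 S).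
Let mul (s t : {s : R | s \in S}) : {s : R | s \in S} :=
  denom (rpredM (svalP s) (svalP t)).

Lemma fracP m s m' s' :
  frac m s = frac m' s' <->
  exists2 t, t \in S & t *: (sval s' *: m) = t *: (sval s *: m').
Proof.
rewrite /frac; split=> [/eqP|e]; last apply/eqP.
  by rewrite piE => /asboolP.
by rewrite piE; apply/asboolP.
Qed.

Lemma frac_surj (u : localization) : exists m s, u = frac m s.
Proof.
exists (repr u).1, (repr u).2.
by rewrite /frac -surjective_pairing reprK.
Qed.

Let add (u v : localization) : localization :=
  frac (sval (repr v).2 *: (repr u).1 + sval (repr u).2 *: (repr v).1)
       (mul (repr u).2 (repr v).2).
Let opp (u : localization) : localization := frac (- (repr u).1) (repr u).2.
Let zero : localization := frac 0 one.
Let scale (a : R) (u : localization) : localization :=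
  frac (a *: (repr u).1) (repr u).2.

Let reprP m s : exists2 t, t \in S &
  t *: (sval s *: (repr (frac m s)).1) = t *: (sval (repr (frac m s)).2 *: m).
Proof. by apply/fracP; rewrite /frac -surjective_pairing reprK. Qed.

Let addE m s m' s' :
  add (frac m s) (frac m' s') = frac (sval s' *: m + sval s *: m') (mul s s').
Proof.
rewrite /add; move: (reprP m s) (reprP m' s').
case: (repr (frac m s)) => n u; case: (repr (frac m' s')) => n' u' /=.
move=> [t tS e] [t' tS' e']; apply/fracP; exists (t * t'); first by rewrite rpredM.
have vmul (a b : {s : R | s \in S}) : sval (mul a b) = sval a * sval b by [].
rewrite !vmul; rewrite !scalerA in e e'; rewrite !scalerDr !scalerA.
congr (_ + _).
  have -> : t * t' * (sval s * sval s') * sval u'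
          = t' * sval s' * sval u' * (t * sval s) by ring.
  by rewrite -scalerA e scalerA; congr (_ *: _); ring.
have -> : t * t' * (sval s * sval s') * sval u
        = t * sval s * sval u * (t' * sval s') by ring.
by rewrite -scalerA e' scalerA; congr (_ *: _); ring.
Qed.

Let oppE m s : opp (frac m s) = frac (- m) s.
Proof.
rewrite /opp; move: (reprP m s); case: (repr (frac m s)) => n u /= [t tS e].
by apply/fracP; exists t; rewrite // !scalerN e.
Qed.

Let scaleE a m s : scale a (frac m s) = frac (a *: m) s.
Proof.
rewrite /scale; move: (reprP m s); case: (repr (frac m s)) => n u /= [t tS e].
apply/fracP; exists t => //; rewrite !scalerA in e *.
have -> : t * sval s * a = a * (t * sval s) by ring.
by rewrite -scalerA e scalerA; congr (_ *: _); ring.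
Qed.

Let fracI m s m' s' : sval s' *: m = sval s *: m' -> frac m s = frac m' s'.
Proof. by move=> e; apply/fracP; exists 1; rewrite ?rpred1 ?e. Qed.

Let addA : associative add.
Proof.
move=> u v w.
have [m1 [s1 ->]] := frac_surj u; have [m2 [s2 ->]] := frac_surj v.
have [m3 [s3 ->]] := frac_surj w; rewrite !addE; apply: fracI.
rewrite /= !scalerDr !scalerA -!addrA.
by congr (_ *: _ + (_ *: _ + _ *: _)); ring.
Qed.

Let addC : commutative add.
Proof.
move=> u v; have [m1 [s1 ->]] := frac_surj u; have [m2 [s2 ->]] := frac_surj v.
by rewrite !addE; apply: fracI; rewrite /= addrC mulrC.
Qed.

Let add0 : left_id zero add.
Proof.
move=> u; have [m [s ->]] := frac_surj u.
by rewrite addE; apply: fracI; rewrite /= scaler0 add0r scale1r mul1r.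
Qed.

Let addN : left_inverse zero opp add.
Proof.
move=> u; have [m [s ->]] := frac_surj u.
by rewrite oppE addE; apply: fracI; rewrite /= scalerN addNr !scaler0.
Qed.

HB.instance Definition _ := GRing.isZmodule.Build localization addA addC add0 addN.

Let scaleA a b u : scale a (scale b u) = scale (a * b) u.
Proof. by have [m [s ->]] := frac_surj u; rewrite !scaleE scalerA. Qed.

Let scale1 : left_id 1 scale.
Proof. by move=> u; have [m [s ->]] := frac_surj u; rewrite scaleE scale1r. Qed.

Let scaleDr : right_distributive scale +%R.
Proof.
move=> a u v; have [m1 [s1 ->]] := frac_surj u.
have [m2 [s2 ->]] := frac_surj v.
rewrite [_ + _]addE !scaleE [RHS]addE; congr frac.
by rewrite scalerDr !scalerA; congr (_ *: _ + _ *: _); ring.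
Qed.

Let scaleDl u : {morph scale^~ u : a b / a + b}.
Proof.
move=> a b; have [m [s ->]] := frac_surj u.
rewrite !scaleE [RHS]addE; apply: fracI.
by rewrite /= -scalerDr -scalerDl [RHS]scalerA.
Qed.

HB.instance Definition _ :=
  GRing.Zmodule_isLmodule.Build R localization scaleA scale1 scaleDr scaleDl.

Lemma frac_add m s m' s' (ss' : sval s * sval s' \in S) :
  frac m s + frac m' s' =
  frac (sval s' *: m + sval s *: m') (denom ss').
Proof. by rewrite [LHS]addE; apply: fracI. Qed.

Lemma frac_scale a m s : a *: frac m s = frac (a *: m) s.
Proof. exact: scaleE. Qed.

End Localization.

(* The canonical map S^-1 M -> T^-1 M, which exists as soon as every element
   of S divides an element of T (S need not be contained in T: this covers
   M_x -> M_(x y)).  It sends m / s to (r m) / (r s) for any r with r s in T,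
   see locmapE. *)
Section LocalizationMap.
Variables (R : comPzRingType) (S T : mulrClosed R) (M : lmodType R).
Hypothesis ST : forall s, s \in S -> exists r, r * s \in T.

Definition locmap (u : localization S M) : localization T M :=
  let: (m, s) := repr u in
  let r := xchoose (ST (svalP s)) in
  frac (r *: m) (denom (xchooseP (ST (svalP s)))).

Lemma locmapE m (s : {s : R | s \in S}) r (rsT : r * sval s \in T) :
  locmap (frac m s) = frac (r *: m) (denom rsT).
Proof.
have: frac (repr (frac m s)).1 (repr (frac m s)).2 = frac m s.
  by rewrite {1}/frac -surjective_pairing reprK.
rewrite /locmap; case: (repr (frac m s)) => n u /= /fracP[t tS e].
set r' := xchoose _; set r'T := xchooseP _.
have [q qT] := ST tS.
apply/fracP; exists (q * t); rewrite //= !scalerA in e *.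
have -> : q * t * (r * sval s) * r' = q * r * r' * (t * sval s) by ring.
by rewrite -scalerA e scalerA; congr (_ *: _); ring.
Qed.

Let locmap_linear : linear locmap.
Proof.
move=> a u v; have [m1 [s1 ->]] := frac_surj u.
have [m2 [s2 ->]] := frac_surj v.
have [r1 h1] := ST (svalP s1); have [r2 h2] := ST (svalP s2).
have s12 : sval s1 * sval s2 \in S by rewrite rpredM ?(svalP s1) ?(svalP s2).
have h12 : (r1 * sval s1) * (r2 * sval s2) \in T by rewrite rpredM.
have h : r1 * r2 * (sval s1 * sval s2) \in T.
  by have <- : r1 * sval s1 * (r2 * sval s2) = r1 * r2 * (sval s1 * sval s2) by ring.
rewrite frac_scale (frac_add _ _ s12).
rewrite (@locmapE _ (denom s12) _ h).
rewrite (locmapE _ h1) (locmapE _ h2) frac_scale.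
rewrite (@frac_add _ _ _ _ (denom h1) _ (denom h2) h12).
apply/fracP; exists 1; rewrite ?rpred1 //.
by rewrite /= !scalerDr !scalerA; congr (_ *: _ + _ *: _); ring.
Qed.

HB.instance Definition _ :=
  GRing.isLinear.Build R (localization S M) (localization T M) _ locmap
    locmap_linear.

End LocalizationMap.

Section Powers.
Variable R : comPzRingType.

Definition powers (x : R) : {pred R} := fun y => `[< exists n, y = x ^+ n >].

Let powers_closed x : mulr_closed (powers x).
Proof.
split=> [|y z]; rewrite !unfold_in; first by apply/asboolP; exists 0%N.
move=> /asboolP[n ->] /asboolP[m ->]; apply/asboolP.
by exists (n + m)%N; rewrite exprD.
Qed.
HB.instance Definition _ x := GRing.isMulClosed.Build R (powers x) (powers_closed x).

Lemma powersMr (x y z : R) : z \in powers x -> exists r, r * z \in powers (x * y).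
Proof.
rewrite unfold_in => /asboolP[n ->]; exists (y ^+ n).
by rewrite unfold_in; apply/asboolP; exists n; rewrite exprMn mulrC.
Qed.

Lemma powersMl (x y z : R) : z \in powers y -> exists r, r * z \in powers (x * y).
Proof. by rewrite mulrC; exact: powersMr. Qed.

End Powers.

Section Cech.
Variables (R : comPzRingType) (k : nat) (x : 'I_k -> R) (M : lmodType R).

Definition cechC0 := dprod (fun i : 'I_k => localization (powers (x i)) M).

Definition cechC1 :=
  dprod (fun ij : {ij : 'I_k * 'I_k | (ij.1 < ij.2)%N} =>
    localization (powers (x (sval ij).1 * x (sval ij).2)) M).

Definition cech_d1 (m : cechC0) : cechC1 := fun ij =>
  locmap (@powersMl R (x (sval ij).1) (x (sval ij).2)) (m (sval ij).2) -
  locmap (@powersMr R (x (sval ij).1) (x (sval ij).2)) (m (sval ij).1).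

Let cech_d1_linear : linear cech_d1.
Proof.
move=> a m n; apply: functional_extensionality_dep => ij.
pose l := locmap (M := M) (@powersMl R (x (sval ij).1) (x (sval ij).2)).
pose r := locmap (M := M) (@powersMr R (x (sval ij).1) (x (sval ij).2)).
transitivity (l (a *: m (sval ij).2 + n (sval ij).2) -
              r (a *: m (sval ij).1 + n (sval ij).1)); first by [].
by rewrite /l /r !linearP addrACA -scalerDr.
Qed.

HB.instance Definition _ :=
  GRing.isLinear.Build R cechC0 cechC1 _ cech_d1 cech_d1_linear.

Definition cechD0 : Type := linear_ker cech_d1.
HB.instance Definition _ := GRing.Lmodule.on cechD0.

End Cech.

Section Spectrum.
Variable R : comPzRingType.

Definition is_prime_ideal (P : set R) : Prop :=
  [/\ P 0, forall a b, P a -> P b -> P (a + b), forall a b, P b -> P (a * b),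
      ~ P 1 & forall a b, P (a * b) -> P a \/ P b].

Record Spec := PrimeIdeal {
  prime_set : set R;
  prime_setP : is_prime_ideal prime_set }.

HB.instance Definition _ := gen_eqMixin Spec.
HB.instance Definition _ := gen_choiceMixin Spec.

Lemma primeM (p : Spec) a b : prime_set p (a * b) <-> prime_set p a \/ prime_set p b.
Proof.
have [_ _ pM _ pP] := prime_setP p; split; first exact: pP.
by case=> h; [rewrite mulrC|]; exact: pM.
Qed.

Definition zero_locus (E : set R) : set Spec := [set p : Spec | E `<=` prime_set p].

Definition zariski_open (U : set Spec) : Prop := exists E, U = ~` zero_locus E.

Let zariskiT : zariski_open setT.
Proof.
exists [set 1]; rewrite -[LHS]setCK setCT; congr (~` _).
apply/esym/seteqP; split=> // p /(_ 1 erefl) /= p1.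
by have [_ _ _ /(_ p1)] := prime_setP p.
Qed.

Let zariskiI : setI_closed zariski_open.
Proof.
move=> _ _ [E ->] [F ->]; exists [set a | exists e f, [/\ E e, F f & a = e * f]].
rewrite -setCU; congr (~` _); apply/seteqP; split=> p.
  by case=> h a [e [f [Ee Ff ->]]]; apply/primeM;
    [left; apply: h | right; apply: h].
move=> h; have [hE|/existsNP[e /not_implyP[Ee pe]]] := pselect (zero_locus E p).
  by left.
right=> f Ff; have /= := h (e * f) (ex_intro _ e (ex_intro _ f (And3 Ee Ff erefl))).
by case/primeM.
Qed.

Let zariski_bigU (T : Type) (f : T -> set Spec) :
  (forall i, zariski_open (f i)) -> zariski_open (\bigcup_i f i).
Proof.
move=> /choice[E fE]; exists (\bigcup_i E i).
rewrite -[LHS]setCK setC_bigcup; congr (~` _); apply/seteqP; split=> p h.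
  by move=> a [i _ Ea]; have := h i I; rewrite fE setCK; exact.
by move=> i _; rewrite fE setCK => a Ea; apply: h; exists i.
Qed.

HB.instance Definition _ :=
  isOpenTopological.Build Spec zariskiT zariskiI zariski_bigU.

Lemma openC_zero_locus (E : set R) : open (~` zero_locus E).
Proof. by exists E. Qed.

Definition prime_compl (p : Spec) : {pred R} := fun a => `[< ~ prime_set p a >].

Let prime_compl_closed p : mulr_closed (prime_compl p).
Proof.
have [_ _ _ p1 _] := prime_setP p.
split=> [|a b]; rewrite !unfold_in; first by apply/asboolP.
by move=> /asboolP pa /asboolP pb; apply/asboolP => /primeM[].
Qed.
HB.instance Definition _ p :=
  GRing.isMulClosed.Build R (prime_compl p) (prime_compl_closed p).

Definition generated_ideal k (x : 'I_k -> R) : set R :=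
  range (fun c : 'I_k -> R => \sum_i c i * x i).

End Spectrum.

(* Gamma(U, M~) for U open: the families of elements of the stalks M_p, p in U,
   that are locally given by a single fraction m / a. The neighbourhood V need
   not lie in U, as the condition only involves V `&` U, which is open. *)
Section Tilde.
Variables (R : comPzRingType) (M : lmodType R) (U : set (Spec R)).

Definition stalks := dprod (fun p : U => localization (prime_compl (val p)) M).

Definition locally_frac : {pred stalks} := fun s =>
  `[< forall p : U, exists V : set (Spec R),
        [/\ open V, V (val p) &
          exists m a, forall q : U, V (val q) ->
            exists aq : a \in prime_compl (val q), s q = frac m (denom aq)] >].

Let locally_frac_closed : submod_closed locally_frac.
Proof.
split=> [|c s t]; rewrite !unfold_in.
  apply/asboolP => p; exists setT; split=> //; first exact: openT.
  exists 0, 1 => q _; exists (rpred1 (prime_compl (val q))).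
  by apply/fracP; exists 1; rewrite ?rpred1.
move=> /asboolP hs /asboolP ht; apply/asboolP => p.
have [V [oV Vp [m [a ma]]]] := hs p; have [W [oW Wp [n [b nb]]]] := ht p.
exists (V `&` W); split; [exact: openI | by split|].
exists (b *: (c *: m) + a *: n), (a * b) => q [Vq Wq].
have [aq sq] := ma q Vq; have [bq tq] := nb q Wq.
exists (rpredM aq bq).
transitivity (c *: s q + t q); first by [].
by rewrite sq tq frac_scale (@frac_add _ _ _ _ (denom aq) _ (denom bq) (rpredM aq bq)).
Qed.

HB.instance Definition _ := GRing.isSubmodClosed.Build R stalks locally_frac
  (GRing.submod_closed_semi locally_frac_closed).

Definition tilde : Type := {s : stalks | s \in locally_frac}.
HB.instance Definition _ := SubChoice.on tilde.
HB.instance Definition _ := [SubChoice_isSubLmodule of tilde by <:].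

End Tilde.

(* Main.v *)
From HB Require Import structures.
Require Import Defs.
From mathcomp Require Import all_boot all_algebra.
From mathcomp Require Import all_classical.
From mathcomp Require Import topology ring.
(* Makes [frac] denote module fractions again, rather than the numerator and
   denominator pair of an element of a fraction field. *)
Import Defs.

Import GRing.Theory.
Local Open Scope ring_scope.
Local Open Scope classical_set_scope.

Set Implicit Arguments.
Unset Strict Implicit.
Unset Printing Implicit Defensive.

(** Write D(f) for the set of primes that do not contain f, so that U is the
    union of the D(x_i). A Cech cocycle (u_i), with u_i in M_{x_i}, has at each
    p in U a germ: the image of u_i in the stalk M_p for any i with p in D(x_i).
    The cocycle condition makes the germ independent of i ([cech_cocycle]), and
    on D(x_i) it is given by the single fraction u_i. This defines the
    isomorphism, and bijectivity comes from two facts about one basic open set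
    D(f).
    - [germ_inj]: an element of M_f is determined by its germs on D(f). This
      gives injectivity. It also gives the cocycle condition in surjectivity,
      when applied in M_{x_i x_j}.
    - [section_basic_open]: on any D(f) contained in U, a section is the family
      of germs of an element of M_f. Over the D(x_i) this gives the components
      of a preimage.

    Both follow from one principle ([pow_mem_ideal]): an ideal whose members
    cannot all lie in a prime that avoids f contains a power of f. For the
    first, the ideal consists of the r that annihilate the difference of two
    numerators over a common denominator. For the second, it consists of the r
    with D(r) inside U such that the section is a single fraction m / a on D(r).
    That this set is closed under addition is the gluing of two fractions
    ([frac_on_add]). By the local description of sections it lies in no prime
    of D(f), so it contains a power of f. The principle thus takes the place of
    the quasi-compactness of D(f), and no finite subcover is extracted. *)

(** * Primes avoiding the powers of an element *)

Section PrimeAvoidance.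
Variable R : comPzRingType.

Definition is_ideal (I : set R) : Prop :=
  [/\ I 0, forall a b, I a -> I b -> I (a + b) & forall a b, I b -> I (a * b)].

Definition adjoin (I : set R) (a : R) : set R :=
  [set y | exists q c, I q /\ y = q + c * a].

Lemma adjoin_ideal I a : is_ideal I -> is_ideal (adjoin I a).
Proof.
move=> [I0 ID IM]; split.
- by exists 0, 0; split; rewrite // mul0r addr0.
- move=> _ _ [q [c [Iq ->]]] [q' [c' [Iq' ->]]]; exists (q + q'), (c + c').
  by split; [exact: ID | ring].
- move=> b _ [q [c [Iq ->]]]; exists (b * q), (b * c).
  by split; [exact: IM | ring].
Qed.

Lemma zero_ideal : is_ideal [set 0].
Proof.
split=> // [a b /= -> ->|a b /= ->]; first by rewrite addr0.
by rewrite mulr0.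
Qed.

Lemma sub_adjoin I a : I `<=` adjoin I a.
Proof. by move=> q Iq; exists q, 0; rewrite mul0r addr0. Qed.

Lemma mem_adjoin I a : is_ideal I -> adjoin I a a.
Proof. by move=> [I0 _ _]; exists 0, 1; rewrite mul1r add0r. Qed.

(** If a and b are outside P, the ideals P + (a) and P + (b) each contain a power
    of f by maximality. The product of these powers lies in P + (ab), so ab is
    outside P. *)
Lemma maximal_avoiding_prime (P : set R) f :
  is_ideal P -> (forall n, ~ P (f ^+ n)) ->
  (forall K, is_ideal K -> P `<=` K -> (forall n, ~ K (f ^+ n)) -> K `<=` P) ->
  is_prime_ideal P.
Proof.
move=> idP Pf maxP; have [P0 PD PM] := idP.
split=> // [|a b Pab]; first by have := Pf 0%N; rewrite expr0.
have pow c : ~ P c -> exists n, adjoin P c (f ^+ n).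
  move=> Pc; apply/not_existsP => Kf; apply: Pc.
  apply: (maxP _ (adjoin_ideal c idP) _ Kf); last exact: mem_adjoin.
  exact: sub_adjoin.
have [|Pa] := pselect (P a); first by left.
have [|Pb] := pselect (P b); first by right.
have [n [q [c [Pq fn]]]] := pow a Pa; have [m [q' [c' [Pq' fm]]]] := pow b Pb.
case: (Pf (n + m)%N); rewrite exprD fn fm.
have -> : (q + c * a) * (q' + c' * b) =
    (q' + c' * b) * q + (c * a * q' + c * c' * (a * b)) by ring.
by apply: (PD); [exact: PM | apply: (PD); exact: PM].
Qed.

(** The intersection of the primes above I is the radical of I. Otherwise an
    ideal above I that is maximal among those containing no power of f would be
    a prime without f. *)
Lemma pow_mem_ideal (I : set R) f : is_ideal I ->
  (forall p : Spec R, I `<=` prime_set p -> prime_set p f) ->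
  exists n, I (f ^+ n).
Proof.
move=> idI If; apply/not_existsP => If0; have [I0 ID IM] := idI.
(* Zorn is applied to the sets A such that A `|` I is a suitable ideal, since
   the union of the empty chain is empty and does not contain I. *)
pose good A := is_ideal (A `|` I) /\ forall n, ~ (A `|` I) (f ^+ n).
have [F Fgood Ftot|A [[idA Af] maxA]] := @Zorn_bigcup R good.
  pose C := \bigcup_(X in F) X; rewrite -/C.
  have sub X : F X -> X `|` I `<=` C `|` I.
    by move=> FX a [Xa|Ia]; [left; exists X | right].
  have inI1 a : (C `|` I) a -> I a \/ exists2 X, F X & (X `|` I) a.
    by move=> [[X FX Xa]|]; [right; exists X => //; left | left].
  split; last first.
    move=> n /inI1[/If0|[X FX]] //.
    by have [_ +] := Fgood X FX; exact.
  split; first by right.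
    move=> a b /inI1[Ia|[X FX Xa]] /inI1[Ib|[Y FY Yb]].
    - by right; exact: ID.
    - have [[_ D _] _] := Fgood Y FY.
      by apply: (sub Y FY); apply: D => //; right.
    - have [[_ D _] _] := Fgood X FX.
      by apply: (sub X FX); apply: D => //; right.
    - have [[_ DX _] _] := Fgood X FX; have [[_ DY _] _] := Fgood Y FY.
      case: (Ftot X Y FX FY) => XY.
        by apply: (sub Y FY); apply: DY => //; case: Xa => [/XY|]; [left|right].
      by apply: (sub X FX); apply: DX => //; case: Yb => [/XY|]; [left|right].
  move=> a b /inI1[Ib|[X FX Xb]]; first by right; exact: IM.
  have [[_ _ MX] _] := Fgood X FX.
  by apply: (sub X FX); exact: MX.
have prA : is_prime_ideal (A `|` I).
  apply: (maximal_avoiding_prime idA Af) => K idK AK Kf.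
  have IK : K `|` I = K by apply/seteqP; split=> a; [case=> // Ia; apply: AK; right | left].
  have [KA|KA] := pselect (K `<=` A); first by move=> a /KA; left.
  by case: (maxA K); [split=> // a Aa; apply: AK; left | rewrite /good IK].
have := If (PrimeIdeal prA) (@subsetUr _ _ _).
by have := Af 1%N; rewrite expr1.
Qed.

End PrimeAvoidance.

(** * Germs of fractions *)

Section Germs.
Variables (R : comPzRingType) (M : lmodType R).

Lemma powers_compl (f : R) (p : Spec R) : ~ prime_set p f ->
  forall s, s \in powers f -> exists r, r * s \in prime_compl p.
Proof.
move=> pf s; rewrite unfold_in => /asboolP[n ->]; exists 1; rewrite mul1r.
by rewrite rpredX // unfold_in; apply/asboolP.
Qed.

Definition germ f (p : Spec R) (pf : ~ prime_set p f) :
    {linear localization (powers f) M -> localization (prime_compl p) M} :=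
  locmap (powers_compl pf).

Lemma powers_expP (f : R) (s : {s | s \in powers f}) : exists n, sval s = f ^+ n.
Proof. by case: s => s /= /asboolP. Qed.

Lemma powers_prime_compl (f : R) (p : Spec R) (s : {s | s \in powers f}) :
  ~ prime_set p f -> sval s \in prime_compl p.
Proof.
move=> pf; have [n ->] := powers_expP s.
by rewrite rpredX // unfold_in; apply/asboolP.
Qed.

Lemma germE f p (pf : ~ prime_set p f) m s (ps : sval s \in prime_compl p) :
  germ pf (frac m s) = frac m (denom ps).
Proof.
have ps1 : 1 * sval s \in prime_compl p by rewrite mul1r.
rewrite /germ /= (locmapE _ _ ps1) scale1r.
by apply/fracP; exists 1; rewrite ?rpred1 //= mul1r.
Qed.

(** The germ at p of an element of M_f may be computed after restriction to
    M_g, as in M_x -> M_(x y) -> M_p. *)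
Lemma germ_locmap f g (h : forall s, s \in powers f -> exists r, r * s \in powers g)
    p (pf : ~ prime_set p f) (pg : ~ prime_set p g) u :
  germ pg (locmap h u) = germ pf u.
Proof.
have [m [s ->]] := frac_surj u; have [r rs] := h _ (svalP s).
have ps := powers_prime_compl s pf.
rewrite (locmapE _ _ rs) (germE _ _ ps) (germE pg _ (powers_prime_compl (denom rs) pg)).
by apply/fracP; exists 1; rewrite ?rpred1 //= !scalerA; congr (_ *: _); ring.
Qed.

Lemma annihilator_ideal (n : M) : is_ideal [set r : R | r *: n = 0].
Proof.
split=> [|a b /= an bn|a b /= bn]; first by rewrite /= scale0r.
  by rewrite scalerDl an bn addr0.
by rewrite -scalerA bn scaler0.
Qed.

(** The link with [pow_mem_ideal]: equality of two fractions at p produces an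
    annihilator of the difference of their numerators outside p. *)
Lemma eq_frac_stalk (p : Spec R) m s m' s' :
  frac m s = frac m' s' :> localization (prime_compl p) M ->
  ~ ([set r : R | r *: (sval s' *: m - sval s *: m') = 0] `<=` prime_set p).
Proof.
move=> /fracP[t]; rewrite unfold_in => /asboolP pt e; apply: contra_not pt; apply.
by rewrite /= scalerBr e subrr.
Qed.

(** The annihilator of s' m - s m' lies in no prime of D(f), by the equality of
    germs there. Hence it contains a power of f, and m / s = m' / s' in M_f. *)
Lemma germ_inj f (u v : localization (powers f) M) :
  (forall p (pf : ~ prime_set p f), germ pf u = germ pf v) -> u = v.
Proof.
have [m [s ->]] := frac_surj u; have [m' [s' ->]] := frac_surj v => uv.
have [|n /= fn] :=
    pow_mem_ideal (f := f) (annihilator_ideal (sval s' *: m - sval s *: m')).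
  move=> p sub; apply: contrapT => pf; have := uv p pf.
  rewrite (germE _ _ (powers_prime_compl s pf)) (germE _ _ (powers_prime_compl s' pf)).
  by move=> /eq_frac_stalk.
apply/fracP; exists (f ^+ n); first by rewrite unfold_in; apply/asboolP; exists n.
by apply/eqP; rewrite -subr_eq0 -scalerBr fn.
Qed.

End Germs.

Arguments germ {R M f p} pf.

(** * Sections over a basic open set *)

Section Sections.
Variables (R : comPzRingType) (M : lmodType R) (U : set (Spec R)).

Lemma notin_primeM (p : Spec R) (r a : R) :
  ~ prime_set p (r * a) <-> ~ prime_set p r /\ ~ prime_set p a.
Proof.
split=> [h|[pr pa] /primeM[]//].
by split=> ?; apply: h; apply/primeM; [left|right].
Qed.

Lemma prime_complP (p : Spec R) a : a \in prime_compl p <-> ~ prime_set p a.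
Proof. by rewrite unfold_in; split=> /asboolP. Qed.

Lemma prime_complX (p : Spec R) r n :
  ~ prime_set p r -> r ^+ n \in prime_compl p.
Proof. by move=> pr; rewrite rpredX //; apply/prime_complP. Qed.

Definition is_frac_on (s : stalks M U) (r : R) (m : M) (a : R) : Prop :=
  forall p : U, ~ prime_set (val p) r ->
    exists pa : a \in prime_compl (val p), s p = frac m (denom pa).

(** The denominator a is only asked to be invertible on D(r), as in the local
    description of sections. That it divides a power of r is recovered in
    [section_basic_open]. The condition that D(r) lies in U is what allows
    [frac_on_add] to compare two fractions at all primes of an intersection. *)
Definition frac_on (s : stalks M U) (r : R) : Prop :=
  (forall p, ~ prime_set p r -> U p) /\ exists m a, is_frac_on s r m a.

Lemma is_frac_on_expand s r m a N :
  is_frac_on s r m a -> is_frac_on s r (r ^+ N *: m) (r ^+ N * a).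
Proof.
move=> sm p pr; have [pa ->] := sm p pr.
have pA : r ^+ N * a \in prime_compl (val p) by rewrite rpredM ?prime_complX.
exists pA; apply/fracP; exists 1; rewrite ?rpred1 //= !scalerA.
by congr (_ *: _); ring.
Qed.

Lemma frac_combine (p : Spec R) (m m' : M) b u v
    (s t : {a | a \in prime_compl p}) :
  b *: m = sval s *: m' -> sval t = u * sval s + v * b ->
  frac m s = frac (u *: m + v *: m') t.
Proof.
move=> e et; apply/fracP; exists 1; rewrite ?rpred1 // !scale1r et.
rewrite scalerDl scalerDr !scalerA [sval s * u]mulrC [sval s * v]mulrC.
by rewrite -[(v * b) *: m]scalerA e scalerA.
Qed.

(** Two fractions m / a on D(r) and m' / b on D(r') that agree on the
    intersection satisfy (r r')^N (b m - a m') = 0 for some N. Expanding them by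
    r^N and r'^N gives fractions m1 / A and m2 / B with B m1 = A m2. Since D(A)
    and D(B) cover D(r + r'), some power of r + r' is u A + v B. Then
    (u m1 + v m2) / (u A + v B) equals m1 / A and m2 / B wherever these are
    defined. *)
Lemma frac_on_add (s : stalks M U) r r' :
  frac_on s r -> frac_on s r' -> frac_on s (r + r').
Proof.
move=> [rU [m [a sm]]] [r'U [m' [b sm']]].
have cover p : ~ prime_set p (r + r') -> ~ prime_set p r \/ ~ prime_set p r'.
  move=> prr'; apply/not_andP => -[pr pr']; apply: prr'.
  by have [_ D _ _ _] := prime_setP p; exact: D.
have [|N /= eqN] :=
    pow_mem_ideal (f := r * r') (annihilator_ideal (b *: m - a *: m')).
  move=> p sub; apply: contrapT => /notin_primeM[pr pr'].
  pose q : U := exist _ p (mem_set (rU p pr)).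
  have [qa sa] := sm q pr; have [qb sb] := sm' q pr'.
  by have := sa; rewrite sb => /esym /eq_frac_stalk.
have sm1 := is_frac_on_expand N sm; have sm2 := is_frac_on_expand N sm'.
set m1 := r ^+ N *: m in sm1; set A := r ^+ N * a in sm1.
set m2 := r' ^+ N *: m' in sm2; set B := r' ^+ N * b in sm2.
have e : B *: m1 = A *: m2.
  apply/eqP; rewrite -subr_eq0 -[X in _ == X]eqN scalerBr /A /B /m1 /m2 !scalerA exprMn.
  by apply/eqP; congr (_ *: _ - _ *: _); ring.
have UU p : ~ prime_set p (r + r') -> U p by move=> /cover[/rU|/r'U].
have idB := adjoin_ideal B (zero_ideal R).
have [p sub|K [_ [u [[_ [v [/= -> ->]]] eK]]]] :=
    pow_mem_ideal (f := r + r') (adjoin_ideal A idB).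
  apply: contrapT => prr'; pose q : U := exist _ p (mem_set (UU p prr')).
  case: (cover _ prr') => [/(sm1 q)|/(sm2 q)] [/prime_complP pX _].
    by apply: pX; apply: sub; exact: mem_adjoin.
  by apply: pX; apply: sub; apply: sub_adjoin; apply: mem_adjoin; exact: zero_ideal.
rewrite add0r [v * B + _]addrC in eK.
split=> //; exists (u *: m1 + v *: m2), ((r + r') ^+ K) => p prr'.
exists (prime_complX K prr'); case: (cover _ prr') => [/sm1|/sm2] [pX ->].
  by apply: frac_combine; [exact: e | exact: eK].
by rewrite addrC; apply: frac_combine; [exact: esym e | rewrite /= eK addrC].
Qed.

Lemma frac_on_ideal (s : stalks M U) : is_ideal (frac_on s).
Proof.
split; [|exact: frac_on_add|].
  have p0 p : prime_set p (0 : R) by case: (prime_setP p).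
  by split=> [p /(_ (p0 p))//|]; exists 0, 0 => p /(_ (p0 _)).
move=> c r [rU [m [a sm]]]; split=> [p /notin_primeM[_ /rU]//|].
by exists m, a => p /notin_primeM[_ /sm].
Qed.

(** A prime of D(f) containing every r with [frac_on s r] would contain h f for
    any basic neighbourhood D(h) of it on which the section is a single
    fraction, but it contains neither h nor f. So [frac_on] holds for some power
    of f, which has the same basic open set as f. *)
Lemma frac_on_basic_open (s : stalks M U) f : s \in locally_frac (U := U) ->
  (forall p, ~ prime_set p f -> U p) -> frac_on s f.
Proof.
rewrite unfold_in => /asboolP sloc fU.
have [p sub|n [fnU [m [a sm]]]] := pow_mem_ideal (f := f) (frac_on_ideal s).
  apply: contrapT => pf; pose q : U := exist _ p (mem_set (fU p pf)).
  have [_ [[E ->] /existsNP[h /not_implyP[Eh ph]] [m [a sm]]]] := sloc q.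
  suff: prime_set p (h * f) by case/primeM.
  apply: sub; split=> [q' /notin_primeM[_ /fU]//|]; exists m, a => q' /notin_primeM[q'h _].
  by apply: sm => /(_ h Eh).
split=> //; exists m, a => p pf; apply: sm; apply/prime_complP.
exact: prime_complX.
Qed.

Lemma section_basic_open (s : stalks M U) f : s \in locally_frac (U := U) ->
  (forall p, ~ prime_set p f -> U p) ->
  exists u : localization (powers f) M,
    forall (p : U) (pf : ~ prime_set (val p) f), s p = germ pf u.
Proof.
move=> sloc fU; have [_ [m [a sm]]] := frac_on_basic_open sloc fU.
(* The denominator a is invertible on D(f), so it divides a power f ^+ n = c * a
   and the section is c m / f^n. *)
have ida := adjoin_ideal a (zero_ideal R).
have [p sub|n [_ [c [/= -> ec]]]] := pow_mem_ideal (f := f) ida.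
  apply: contrapT => pf; pose q : U := exist _ p (mem_set (fU p pf)).
  have [/prime_complP + _] := sm q pf; apply; apply: sub.
  by apply: mem_adjoin; exact: zero_ideal.
rewrite add0r in ec.
have fn : f ^+ n \in powers f by rewrite unfold_in; apply/asboolP; exists n.
exists (frac (c *: m) (denom fn)) => p pf; have [pa ->] := sm p pf.
rewrite (germE _ _ (powers_prime_compl (denom fn) pf)).
by apply/fracP; exists 1; rewrite ?rpred1 //= ec !scale1r !scalerA; congr (_ *: _); ring.
Qed.

End Sections.

(** * From Cech cocycles to sections *)

Section CechToSections.
Variables (R : comPzRingType) (k : nat) (x : 'I_k -> R) (M : lmodType R).

Let U : set (Spec R) := ~` zero_locus (generated_ideal x).

Lemma compl_zero_locusP (p : Spec R) : U p <-> exists i, ~ prime_set p (x i).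
Proof.
rewrite existsNP; split; apply: contra_not => h.
  have [p0 pD pM _ _] := prime_setP p.
  by move=> _ [c _ <-]; apply: big_ind => // i _; exact: pM.
move=> i; apply: h; exists (fun j => (j == i)%:R) => //.
rewrite (bigD1 i) //= eqxx mul1r big1 ?addr0 // => j /negPf ->.
by rewrite mul0r.
Qed.

Lemma coordP (p : U) : exists i, ~ prime_set (val p) (x i).
Proof. by apply/compl_zero_locusP; exact: set_valP. Qed.

Definition coord (p : U) : 'I_k := sval (cid (coordP p)).

Lemma coord_notin (p : U) : ~ prime_set (val p) (x (coord p)).
Proof. exact: (svalP (cid (coordP p))). Qed.

(** At p the value is the germ of the component at one chosen index;
    [cech_stalks_germ] removes the choice. *)
Definition cech_stalks (m : cechD0 x M) : stalks M U :=
  fun p => germ (@coord_notin p) (val m (coord p)).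

(** The kernel condition compares u_i and u_j in M_{x_i x_j}, through which both
    germs factor because p lies in D(x_i x_j). *)
Lemma cech_cocycle (m : cechD0 x M) (i j : 'I_k) p
    (pi : ~ prime_set p (x i)) (pj : ~ prime_set p (x j)) :
  germ pi (val m i) = germ pj (val m j).
Proof.
wlog ij : i j pi pj / (i < j)%N.
  move=> H; case: (ltngtP i j) => [ij|ij|/ord_inj ij]; first exact: H.
    by apply/esym; exact: H.
  by move: pi pj; rewrite ij => pi pj; congr (germ _ _); exact: Prop_irrelevance.
have pij : ~ prime_set p (x i * x j) by apply/notin_primeM.
have /eqP mE := valP m.
have /eqP : cech_d1 (val m) (exist _ (i, j) ij) = 0 by rewrite mE.
rewrite subr_eq0 => /eqP /= e.
by rewrite -(germ_locmap (@powersMr R (x i) (x j)) pi pij) -e germ_locmap.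
Qed.

Lemma cech_stalks_germ (m : cechD0 x M) i (p : U) (pi : ~ prime_set (val p) (x i)) :
  cech_stalks m p = germ pi (val m i).
Proof. exact: cech_cocycle. Qed.

Lemma cech_stalks_locally_frac m : cech_stalks m \in locally_frac (U := U).
Proof.
rewrite unfold_in; apply/asboolP => p; have [i pi] := coordP p.
exists (~` zero_locus [set x i]); split; first exact: openC_zero_locus.
  by move=> /(_ (x i) erefl).
have [n [s mi]] := frac_surj (val m i); exists n, (sval s) => q qV.
have qi : ~ prime_set (val q) (x i) by move=> h; apply: qV => _ ->.
have qs := powers_prime_compl s qi; exists qs.
by rewrite (cech_stalks_germ m qi) mi (germE _ _ qs).
Qed.

Definition cech_section (m : cechD0 x M) : tilde M U :=
  exist _ (cech_stalks m) (cech_stalks_locally_frac m).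

Lemma cech_section_linear : linear cech_section.
Proof.
move=> a m n; apply: val_inj; apply: functional_extensionality_dep => p.
exact: (linearP (germ (@coord_notin p))).
Qed.

HB.instance Definition _ :=
  GRing.isLinear.Build R (cechD0 x M) (tilde M U) _ cech_section
    cech_section_linear.

Lemma cech_section_inj : injective cech_section.
Proof.
move=> m n mn; apply: val_inj; apply: functional_extensionality_dep => i.
apply: germ_inj => p pi.
have pU : U p by apply/compl_zero_locusP; exists i.
pose q : U := exist _ p (mem_set pU).
rewrite -(@cech_stalks_germ m i q pi) -(@cech_stalks_germ n i q pi).
exact: (congr1 (fun s : tilde M U => val s q) mn).
Qed.

(** By [section_basic_open] the section comes from some u_i in M_{x_i} on each
    D(x_i). The images of u_i and u_j in M_{x_i x_j} have the same germs, so
    [germ_inj] makes the family (u_i) a cocycle. *)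
Lemma cech_section_surj (s : tilde M U) : exists m, cech_section m = s.
Proof.
have ex_u : forall i, exists u : localization (powers (x i)) M,
    forall (p : U) (pf : ~ prime_set (val p) (x i)), val s p = germ pf u.
  move=> i; apply: section_basic_open; first exact: valP.
  by move=> p pi; apply/compl_zero_locusP; exists i.
pose u i := sval (cid (ex_u i)).
have su i := svalP (cid (ex_u i)).
have u_ker : cech_d1 (u : cechC0 x M) == 0.
  apply/eqP; apply: functional_extensionality_dep => -[[i j] ij] /=.
  apply: (@germ_inj R M) => p pij; rewrite linear0 linearB /=.
  have [pi pj] := (notin_primeM p (x i) (x j)).1 pij.
  rewrite (germ_locmap _ pj) (germ_locmap _ pi).
  have pU : U p by apply/compl_zero_locusP; exists i.
  pose q : U := exist _ p (mem_set pU).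
  by rewrite -(su i q pi) -(su j q pj) subrr.
exists (exist _ (u : cechC0 x M) u_ker).
apply: val_inj; apply: functional_extensionality_dep => p.
exact/esym/su.
Qed.

End CechToSections.

Theorem corollary5p2 (R : comPzRingType) (k : nat) (x : 'I_k -> R)
    (M : lmodType R) :
  exists f : {linear cechD0 x M -> tilde M (~` zero_locus (generated_ideal x))},
    bijective f.
Proof.
exists (@cech_section R k x M : {linear _ -> _}).
have /choice[g gK] := @cech_section_surj R k x M.
by exists g => // m; apply: cech_section_inj; rewrite gK.
Qed.
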